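(* Let $P$ be a set of skew-indecomposable (non-empty) permutations and let $n\ge 0$. Then the staircase encoding $\mathrm{SE}$ is a bijection between $\mathrm{Av}^{(n)}(2314,3124,1\oplus P)$ and $\mathrm{WI}(\mathcal{U}(B_n),\mathrm{Av}^{+}(2314,3124,P))$.
   Context: A permutation of size $n$ is a word containing each of $1,\dots,n$ exactly once. $\sigma$ contains $\pi$ if some (not necessarily consecutive) subsequence of $\sigma$ has the same relative order as $\pi$; otherwise $\sigma$ avoids $\pi$. For a set $P$ of permutations, $\mathrm{Av}(P)$ is the set of permutations avoiding every element of $P$, and $\mathrm{Av}^{+}(P)$ its non-empty elements. For $\alpha$ of size $a$ and $\beta$ of size $b$: $\alpha\oplus\beta=\alpha_1\cdots\alpha_a(\beta_1+a)\cdots(\beta_b+a)$ and $\alpha\ominus\beta=(\alpha_1+b)\cdots(\alpha_a+b)\beta_1\cdots\beta_b$. A permutation is skew-indecomposable if it cannot be written as $\alpha\ominus\beta$ with $\alpha,\beta$ non-empty. $1\oplus P=\{1\oplus\pi:\pi\in P\}$. The empty permutation is not in $P$. A left-to-right minimum of $\sigma$ is an entry $\sigma_i$ with $\sigma_j>\sigma_i$ for all $j<i$. $\mathrm{Av}^{(n)}(Q)$ denotes the permutations in $\mathrm{Av}(Q)$ with exactly $n$ left-to-right minima. The staircase grid is $B_n=\{(i,j):1\le i\le j\le n\}$ ($B_0=\emptyset$), cells indexed as (row, column), row $1$ on top. If $\sigma$ has left-to-right minima at positions $p_1<\dots<p_n$ with values $v_1>\dots>v_n$, every entry $\sigma_k$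 that is not a left-to-right minimum lies in cell $(i,j)$ where $j$ is the largest index with $p_j<k$ and $i$ is the smallest index with $v_i<\sigma_k$ (so $i\le j$). The staircase encoding $\mathrm{SE}(\sigma)$ is the filling of $B_n$ putting in each cell the standardization of the subsequence of entries of $\sigma$ lying in that cell (the empty permutation if there are none). A cell is active if its content is non-empty. The up-core $\mathcal{U}(B_n)$ is the graph on vertex set $B_n$ with an edge between $(i,j)$ and $(k,\ell)$ whenever $i>k$ and $j<\ell$. For a graph $G$ on $B_n$ and a set $S$ of non-empty permutations, $\mathrm{WI}(G,S)$ is the set of fillings of $B_n$ whose set of non-empty cells is an independent set of $G$ and whose non-empty cells all contain elements of $S$. ''SE is a bijection between $X$ and $Y$'' means the restriction of SE to $X$ is injective with image exactly $Y$. *)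

(* Defs.v *)
From mathcomp Require Import all_boot.
From mathcomp Require Import boolp classical_sets functions.

Set Implicit Arguments.
Unset Strict Implicit.
Unset Printing Implicit Defensive.

Local Open Scope classical_set_scope.

(* Permutations are words over nat in one-line notation, with values starting
   at 1; positions in a word start at 0. *)
Definition is_perm (s : seq nat) : Prop := perm_eq s (iota 1 (size s)).

Definition same_order (s t : seq nat) : Prop :=
  size s = size t /\
  forall i j, i < size s -> j < size s ->
    (nth 0 s i < nth 0 s j) = (nth 0 t i < nth 0 t j).

Definition contains (s p : seq nat) : Prop :=
  exists2 t, subseq t s & same_order t p.

Definition Av (Q : set (seq nat)) : set (seq nat) :=
  [set s | is_perm s /\ forall p, Q p -> ~ contains s p].

Definition Av_plus (Q : set (seq nat)) : set (seq nat) :=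
  [set s | Av Q s /\ s <> [::]].

Definition direct_sum (a b : seq nat) : seq nat :=
  a ++ [seq x + size a | x <- b].

Definition skew_sum (a b : seq nat) : seq nat :=
  [seq x + size b | x <- a] ++ b.

Definition skew_indecomposable (s : seq nat) : Prop :=
  forall a b, is_perm a -> is_perm b -> a <> [::] -> b <> [::] ->
    s <> skew_sum a b.

Definition one_plus (P : set (seq nat)) : set (seq nat) :=
  [set direct_sum [:: 1] p | p in P].

Definition is_lrmin (s : seq nat) (k : nat) : bool :=
  all (fun j => nth 0 s k < nth 0 s j) (iota 0 k).

Definition lrmin_pos (s : seq nat) : seq nat :=
  [seq k <- iota 0 (size s) | is_lrmin s k].

Definition lrmin_val (s : seq nat) : seq nat :=
  [seq nth 0 s k | k <- lrmin_pos s].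

Definition Av_n (n : nat) (Q : set (seq nat)) : set (seq nat) :=
  [set s | Av Q s /\ size (lrmin_pos s) = n].

(* The staircase grid B_n. Rows and columns are numbered from 0, so the cell
   (i, j) of the usual 1-based convention is the pair (i - 1, j - 1). *)
Definition cell (n : nat) : finType := {c : 'I_n * 'I_n | c.1 <= c.2}.
Definition row n (c : cell n) : nat := (val c).1.
Definition col n (c : cell n) : nat := (val c).2.

Definition filling (n : nat) := {ffun cell n -> seq nat}.

Definition standardize (s : seq nat) : seq nat :=
  [seq (count (fun y => y < x) s).+1 | x <- s].

Definition in_col (s : seq nat) (j k : nat) : bool :=
  let p := lrmin_pos s in
  (nth 0 p j < k) &&
  all (fun j' => (nth 0 p j' < k) ==> (j' <= j)) (iota 0 (size p)).

Definition in_row (s : seq nat) (i k : nat) : bool :=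
  let v := lrmin_val s in
  (nth 0 v i < nth 0 s k) &&
  all (fun i' => (nth 0 v i' < nth 0 s k) ==> (i <= i')) (iota 0 (size v)).

Definition in_cell (s : seq nat) (i j k : nat) : bool :=
  [&& ~~ is_lrmin s k, in_row s i k & in_col s j k].

(* Meaningful when s has exactly n left-to-right minima: only then are all the
   indices i, j < n used by the cells those of left-to-right minima of s. *)
Definition SE (n : nat) (s : seq nat) : filling n :=
  [ffun c : cell n =>
     standardize
       [seq nth 0 s k | k <- iota 0 (size s) & in_cell s (row c) (col c) k]].

Definition active n (f : filling n) : set (cell n) :=
  [set c | f c <> [::]].

Definition up_core (n : nat) : rel (cell n) :=
  fun c d => ((row c > row d) && (col c < col d))
          || ((row d > row c) && (col d < col c)).

Definition independent (T : Type) (G : rel T) (A : set T) : Prop :=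
  forall c d, A c -> A d -> ~~ G c d.

Definition WI (n : nat) (G : rel (cell n)) (S : set (seq nat)) :
    set (filling n) :=
  [set f | independent G (active f) /\ forall c, active f c -> S (f c)].

(* Main.v *)
Require Import Defs.
From mathcomp Require Import all_boot.
From mathcomp Require Import boolp classical_sets functions.
From mathcomp Require Import zify.

Set Implicit Arguments.
Unset Strict Implicit.
Unset Printing Implicit Defensive.

Local Open Scope classical_set_scope.

(* Let k < l be positions of entries that are not left-to-right minima. If the
   row of k is below that of l, the minima bounding these two rows form a 3124
   with them; if k is in an earlier column than l and has a smaller value, the
   minimum bounding the row of k and the one opening the column of l form a
   2314 with them. Hence, when both patterns are avoided, the active cells form
   a chain from the upper left to the lower right, and any two entries of
   distinct cells are in decreasing order. The permutation is then determined
   by its cells: reading columns left to right, each from top to bottom, gives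
   the positions, and reading rows bottom to top, each from right to left,
   gives the values.
   Conversely, fill the staircase along such a chain. In an occurrence of 2314
   or 3124 two of the entries are ascending and not minima, so they share a
   cell; the others lie between known entries of this cell in position or in
   value, so they are in it too. In an occurrence of 1 (+) p the copy of p
   avoids the minima, hence lives in a skew sum of cell contents, and in a
   single cell as p is skew-indecomposable. *)

(** * Order isomorphism and standardization *)

Lemma map_nth_iota_size (T : Type) (x0 : T) (s : seq T) :
  [seq nth x0 s k | k <- iota 0 (size s)] = s.
Proof. exact: mkseq_nth. Qed.

Lemma same_order_sym s t : same_order s t -> same_order t s.
Proof.
by case=> sz H; split=> // i j hi hj; rewrite H // sz.
Qed.

Lemma same_order_trans s t u :
  same_order s t -> same_order t u -> same_order s u.
Proof.
case=> sz1 H1 [sz2 H2]; split; first by rewrite sz1.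
by move=> i j hi hj; rewrite H1 // H2 // -sz1.
Qed.

Lemma same_order_map (f : nat -> nat) s :
  {in s &, {mono f : x y / x < y}} -> same_order (map f s) s.
Proof.
move=> hf; split; first by rewrite size_map.
by move=> i j; rewrite size_map => hi hj; rewrite !(nth_map 0) // hf // mem_nth.
Qed.

Lemma count_ltn_mono s :
  {in s &, {mono (fun x => (count (fun y => y < x) s).+1) : x y / x < y}}.
Proof.
move=> x y hx hy; rewrite ltnS.
have [hxy|hyx] := ltnP x y; last first.
  by apply: negbTE; rewrite -leqNgt; apply: sub_count => z /= hz; lia.
have -> : count (fun z => z < y) s = count (fun z => z < x) s +
          count (fun z => x <= z < y) s.
  elim: s {hx hy} => //= z s ->; lia.
by rewrite -[ltnLHS]addn0 ltn_add2l -has_count; apply/hasP; exists x => //=; lia.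
Qed.

Lemma standardize_same_order s : same_order (standardize s) s.
Proof. exact/same_order_map/count_ltn_mono. Qed.

Lemma eq_standardize s t : same_order s t -> standardize s = standardize t.
Proof.
case=> sz H; apply: (@eq_from_nth _ 0); first by rewrite !size_map.
move=> i; rewrite size_map => hi; rewrite !(nth_map 0) -?sz //; congr _.+1.
rewrite -{2}(map_nth_iota_size 0 s) -{2}(map_nth_iota_size 0 t) !count_map sz.
apply: eq_in_count => k; rewrite mem_iota /= -sz => hk; exact: H.
Qed.

Lemma is_perm_uniq s : is_perm s -> uniq s.
Proof. by move/perm_uniq->; rewrite iota_uniq. Qed.

Lemma mem_is_perm s x : is_perm s -> (x \in s) = (0 < x <= size s).
Proof. by move=> h; rewrite (perm_mem h) mem_iota; lia. Qed.

Lemma standardize_id s : is_perm s -> standardize s = s.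
Proof.
move=> h; rewrite -[RHS]map_id; apply/eq_in_map => x; rewrite (mem_is_perm _ h).
move=> hx; move/permP: h => ->.
have -> : size s = x.-1 + (size s - x.-1) by lia.
rewrite iotaD count_cat.
rewrite (@eq_in_count _ _ predT); last by move=> y; rewrite mem_iota /=; lia.
rewrite count_predT size_iota (@eq_in_count _ _ pred0 (iota _ (_ - _))).
  by rewrite count_pred0; lia.
by move=> y; rewrite mem_iota /=; lia.
Qed.

(** The ranks are distinct, and none exceeds the size because an entry is not below itself; by
    cardinality they exhaust [1] to [size s]. *)
Lemma is_perm_standardize s : uniq s -> is_perm (standardize s).
Proof.
move=> us.
have ust : uniq (standardize s).
  rewrite map_inj_in_uniq // => x y hx hy hxy.
  have := count_ltn_mono hx hy; have := count_ltn_mono hy hx.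
  by rewrite hxy ltnn; lia.
rewrite /is_perm; apply: uniq_perm => //; first exact: iota_uniq.
suff hsub : {subset standardize s <= iota 1 (size (standardize s))}.
  by have [] := uniq_min_size ust hsub _; rewrite ?size_iota.
move=> _ /mapP[x hx ->]; rewrite mem_iota size_map add1n !ltnS /=.
rewrite -(count_predC (fun y => y < x) s) -[ltnLHS]addn0 ltn_add2l -has_count.
by apply/hasP; exists x => //=; rewrite ltnn.
Qed.

Lemma is_perm_same_order_inj s t :
  is_perm s -> is_perm t -> same_order s t -> s = t.
Proof.
by move=> hs ht /eq_standardize; rewrite !standardize_id.
Qed.

(** * Pattern occurrences as increasing lists of positions *)

Lemma subseq_map_nth (T : eqType) (x0 : T) (s : seq T) ks :
  sorted ltn ks -> all (fun k => k < size s) ks ->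
  subseq [seq nth x0 s k | k <- ks] s.
Proof.
move=> sks /allP hks; rewrite -{2}(map_nth_iota_size x0 s); apply: map_subseq.
(* A strictly increasing list is determined by its set of elements. *)
have -> : ks = [seq k <- iota 0 (size s) | k \in ks].
  apply: (irr_sorted_eq ltn_trans ltnn) => //.
    exact: (sorted_filter ltn_trans _ (iota_ltn_sorted _ _)).
  move=> k; rewrite mem_filter mem_iota /=.
  by have [/hks ->|] := boolP (k \in ks).
exact: filter_subseq.
Qed.

Lemma subseq_nth_index (T : eqType) (x0 : T) (t s : seq T) :
  subseq t s ->
  exists2 ks, sorted ltn ks /\ all (fun k => k < size s) ks &
              t = [seq nth x0 s k | k <- ks].
Proof.
case/subseqP=> m sz ->; exists (mask m (iota 0 (size s))).
  have hsub : subseq (mask m (iota 0 (size s))) (iota 0 (size s)).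
    exact: mask_subseq.
  split; first exact: (subseq_sorted ltn_trans hsub (iota_ltn_sorted _ _)).
  by apply/allP => k /(mem_subseq hsub); rewrite mem_iota.
by rewrite map_mask map_nth_iota_size.
Qed.

Lemma containsP s p :
  contains s p <->
  exists2 ks, sorted ltn ks /\ all (fun k => k < size s) ks &
              same_order [seq nth 0 s k | k <- ks] p.
Proof.
split=> [[t /(subseq_nth_index 0)[ks hks ->]]|[ks [h1 h2] h]].
  by move=> h; exists ks.
by exists [seq nth 0 s k | k <- ks] => //; apply: subseq_map_nth.
Qed.

Lemma same_order_map_nth s t ks :
  same_order s t -> all (fun k => k < size s) ks ->
  same_order [seq nth 0 s k | k <- ks] [seq nth 0 t k | k <- ks].
Proof.
case=> sz H /all_nthP hks; split; first by rewrite !size_map.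
move=> i j; rewrite size_map => hi hj.
by rewrite !(nth_map 0) // H //; apply: hks.
Qed.

Lemma contains_same_order s t p : same_order s t -> contains s p -> contains t p.
Proof.
move=> hst /containsP[ks [sks hks] h]; apply/containsP; exists ks.
  by split; rewrite // -(proj1 hst).
apply: same_order_trans h; apply: same_order_sym; exact: same_order_map_nth.
Qed.

Lemma contains_subseq s t p : subseq s t -> contains s p -> contains t p.
Proof. by move=> hst [u hus hu]; exists u => //; apply: subseq_trans hst. Qed.

(** * Skew sums, and patterns with a leading [1] put below *)

Lemma standardize_cat a b :
  (forall x y, x \in a -> y \in b -> y < x) ->
  standardize (a ++ b) = skew_sum (standardize a) (standardize b).
Proof.
move=> h; rewrite /standardize /skew_sum map_cat -map_comp size_map.
congr (_ ++ _); apply/eq_in_map => x hx /=; rewrite count_cat.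
  rewrite (@eq_in_count _ _ predT b); last by move=> y /(h _ _ hx).
  by rewrite count_predT addSn.
rewrite (@eq_in_count _ _ pred0 a) ?count_pred0 // => y hy /=.
by have := h _ _ hy hx; lia.
Qed.

(** Otherwise standardizing the prefix of length [m] and the remaining suffix would write [p] as a
    skew sum of two non-empty permutations. *)
Lemma skew_indecomposable_split p m :
  is_perm p -> skew_indecomposable p -> 0 < m < size p ->
  ~ (forall i j, i < m <= j -> j < size p -> nth 0 p j < nth 0 p i).
Proof.
move=> pp ip hm h; have up := is_perm_uniq pp.
have {}up : uniq (take m p ++ drop m p) by rewrite cat_take_drop.
move: up; rewrite cat_uniq => /and3P[u1 _ u2].
have ht : size (take m p) = m by rewrite size_takel //; case/andP: hm => _ /ltnW.
apply: (ip (standardize (take m p)) (standardize (drop m p)));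
  try exact: is_perm_standardize.
- by move/(congr1 size); rewrite size_map /= ht; lia.
- by move/(congr1 size); rewrite size_map /= size_drop; lia.
rewrite -standardize_cat ?cat_take_drop ?standardize_id // => x y.
move=> /(nthP 0)[i hi <-] /(nthP 0)[j hj <-].
rewrite ht in hi; rewrite size_drop in hj.
by rewrite nth_take // nth_drop; apply: h; rewrite ?hi ?leq_addr // -ltn_subRL.
Qed.

Lemma same_order_cons v s p :
  is_perm p -> all (fun x => v < x) s -> same_order s p ->
  same_order (v :: s) (direct_sum [:: 1] p).
Proof.
move=> pp /all_nthP hv [sz H].
(* Positivity of the entries of [p] puts the leading [1] strictly below the shifted entries
   [x + 1]. *)
have hp i : i < size p -> 0 < nth 0 p i.
  by move=> /(mem_nth 0); rewrite (mem_is_perm _ pp) => /andP[].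
split=> [|[|i] [|j]] /=; rewrite ?size_map ?sz ?ltnn //.
- by move=> _ hj; rewrite (nth_map 0) // addn1 ltnS hp // hv // sz.
- move=> hi _; rewrite (nth_map 0) // addn1 ltnS leqn0.
  by have := hv 0 i; have := hp i; rewrite sz; lia.
- by move=> hi hj; rewrite !(nth_map 0) // ltn_add2r H // sz.
Qed.

Lemma same_order_consE v s p :
  same_order (v :: s) (direct_sum [:: 1] p) -> is_perm p ->
  all (fun x => v < x) s /\ same_order s p.
Proof.
move=> [/= [sz] H] pp; rewrite size_map in sz.
have hp i : i < size p -> 0 < nth 0 p i.
  by move=> /(mem_nth 0); rewrite (mem_is_perm _ pp) => /andP[].
split.
  apply/(all_nthP 0) => i hi; have := H 0 i.+1 isT hi.
  by rewrite /= (nth_map 0) -?sz // => ->; rewrite addn1 ltnS hp // -sz.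
split=> // i j hi hj; have := H i.+1 j.+1 hi hj.
by rewrite /= !(nth_map 0) -?sz // ltn_add2r.
Qed.

Lemma contains4 s a b c d x y z t :
  [/\ a < b, b < c, c < d & d < size s] ->
  same_order [:: nth 0 s a; nth 0 s b; nth 0 s c; nth 0 s d] [:: x; y; z; t] ->
  contains s [:: x; y; z; t].
Proof.
move=> [h1 h2 h3 h4] h; apply/containsP; exists [:: a; b; c; d] => //=.
by split; lia.
Qed.

(** A predicate that passes to earlier indices holds exactly on an initial segment, whose length is
    the count. This turns the counts in [row_of] and [col_of] into comparisons of indices. *)
Lemma nth_count_prefix (a : pred nat) s :
  (forall i j, i <= j -> j < size s -> a (nth 0 s j) -> a (nth 0 s i)) ->
  forall i, i < size s -> a (nth 0 s i) = (i < count a s).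
Proof.
elim: s => //= x s IH h; have [ax|nax] := boolP (a x).
  case=> [|i] hi //=; rewrite add1n ltnS; apply: IH => // i' j hij hj.
  exact: (h i'.+1 j.+1).
have hs j : j < size s -> ~~ a (nth 0 s j).
  by move=> hj; apply: contra nax; apply: (h 0 j.+1).
have -> : count a s = 0.
  by apply/eqP; rewrite -leqn0 leqNgt -has_count; apply/(has_nthP 0) => -[j /hs/negP].
by case=> [|i] hi /=; rewrite ?(negbTE nax) //; apply/negbTE/hs.
Qed.

(* The row and the column of the position [k], also when it carries a
   left-to-right minimum, which is put on the diagonal. *)
Definition row_of (s : seq nat) (k : nat) : nat :=
  count (fun v => nth 0 s k < v) (lrmin_val s).

Definition col_of (s : seq nat) (k : nat) : nat :=
  (count (fun p => p <= k) (lrmin_pos s)).-1.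

(** * Left-to-right minima and the cells they bound *)

Section LRMinima.

Variable s : seq nat.
Local Notation minpos j := (nth 0 (lrmin_pos s) j).
Local Notation minval j := (nth 0 s (minpos j)).
Local Notation n := (size (lrmin_pos s)).

Lemma lrmin_posP k : (k \in lrmin_pos s) = (k < size s) && is_lrmin s k.
Proof. by rewrite mem_filter mem_iota /= andbC. Qed.

Lemma is_lrminP k :
  reflect (forall j, j < k -> nth 0 s k < nth 0 s j) (is_lrmin s k).
Proof.
apply: (iffP allP) => h j; first by move=> hj; apply: h; rewrite mem_iota.
by rewrite mem_iota /=; apply: h.
Qed.

Lemma lrmin_pos_sorted : sorted ltn (lrmin_pos s).
Proof. exact: (sorted_filter ltn_trans _ (iota_ltn_sorted _ _)). Qed.

Lemma minposP j : j < n -> minpos j < size s /\ is_lrmin s (minpos j).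
Proof. by move=> /(mem_nth 0); rewrite lrmin_posP => /andP. Qed.

Lemma ltn_minpos i j : i < j -> j < n -> minpos i < minpos j.
Proof.
move=> hij hj; apply: (sorted_ltn_nth ltn_trans 0 lrmin_pos_sorted) => //.
by rewrite inE; apply: ltn_trans hj.
Qed.

Lemma ltn_minval i j : i < j -> j < n -> minval j < minval i.
Proof.
move=> hij hj; have [_ /is_lrminP] := minposP hj; apply; exact: ltn_minpos.
Qed.

Lemma nth_lrmin_val j : j < n -> nth 0 (lrmin_val s) j = minval j.
Proof. by move=> hj; rewrite (nth_map 0). Qed.

(** The values of the minima decrease, so the minima lying above the entry form an initial segment.
    In this weak form it also holds when [k] is a minimum. *)
Lemma row_ofP i k : i < n -> (minval i <= nth 0 s k) = (row_of s k <= i).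
Proof.
move=> hi; rewrite leqNgt [RHS]leqNgt; congr (~~ _).
rewrite -nth_lrmin_val //.
apply: (@nth_count_prefix (fun v => nth 0 s k < v)); rewrite size_map //.
move=> i' j hij hj; rewrite !nth_lrmin_val //; last exact: leq_ltn_trans hj.
have [->//|hne] := eqVneq i' j; move=> h; apply: ltn_trans h _.
by apply: ltn_minval => //; rewrite ltn_neqAle hne.
Qed.

(** A non-minimum has an earlier entry that is no larger, and descending in this way ends at a
    minimum. Having one [j] for both bounds is what yields [leq_row_col]. *)
Lemma lrmin_below k :
  k < size s -> exists2 j, j < n & minpos j <= k /\ minval j <= nth 0 s k.
Proof.
elim/ltn_ind: k => k IH hk.
have [mk|] := boolP (is_lrmin s k).
  have hin : k \in lrmin_pos s by rewrite lrmin_posP hk.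
  by exists (index k (lrmin_pos s)); rewrite ?index_mem // nth_index.
case/allPn => j; rewrite mem_iota -leqNgt /= => hj hle.
have [i hi [h1 h2]] := IH j hj (ltn_trans hj hk).
by exists i => //; split; [exact: leq_trans (ltnW hj) | exact: leq_trans hle].
Qed.

Lemma col_ofP j k : k < size s -> j < n -> (minpos j <= k) = (j <= col_of s k).
Proof.
move=> hk hj.
have h i : i < n -> (minpos i <= k) = (i < count (fun p => p <= k) (lrmin_pos s)).
  apply: (@nth_count_prefix (fun p => p <= k)) => {}i j' hij hj'.
  apply: leq_trans; have [->//|hne] := eqVneq i j'.
  by apply/ltnW/ltn_minpos => //; rewrite ltn_neqAle hne.
(* Some minimum stands at or before [k], so the count is positive and the predecessor in [col_of]
   does not truncate. *)
have [i hi [+ _]] := lrmin_below hk; rewrite !h // /col_of; lia.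
Qed.

Lemma ltn_col_of k : k < size s -> col_of s k < n.
Proof.
move=> /lrmin_below[i hi _]; rewrite /col_of.
have := count_size (fun p => p <= k) (lrmin_pos s); lia.
Qed.

Lemma leq_row_col k : k < size s -> row_of s k <= col_of s k.
Proof.
move=> hk; have [i hi [h1 h2]] := lrmin_below hk.
rewrite row_ofP // in h2; rewrite col_ofP // in h1; exact: leq_trans h1.
Qed.

Lemma leq_col_of k l : k <= l -> col_of s k <= col_of s l.
Proof.
move=> hkl; rewrite /col_of -!subn1 leq_sub2r //.
by apply: sub_count => p /= /leq_trans; apply.
Qed.

Lemma leq_row_of k l : nth 0 s k <= nth 0 s l -> row_of s l <= row_of s k.
Proof. by move=> hkl; apply: sub_count => v /=; apply: leq_ltn_trans. Qed.

Lemma minpos_col_of k : k < size s -> is_lrmin s k -> minpos (col_of s k) = k.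
Proof.
move=> hk mk; have hc := ltn_col_of hk.
have hin : k \in lrmin_pos s by rewrite lrmin_posP hk.
have hn : index k (lrmin_pos s) < n by rewrite index_mem.
have := col_ofP hk hn; rewrite nth_index // leqnn => /esym hle.
apply/eqP; rewrite eqn_leq (col_ofP hk) // leqnn /=.
have [h|h] := eqVneq (index k (lrmin_pos s)) (col_of s k).
  by rewrite -h nth_index.
rewrite -{1}(nth_index 0 hin); apply/ltnW/ltn_minpos => //.
by rewrite ltn_neqAle h.
Qed.

Lemma row_of_lrmin k : k < size s -> is_lrmin s k -> row_of s k = col_of s k.
Proof.
move=> hk mk; have hc := ltn_col_of hk.
apply/eqP; rewrite eqn_leq leq_row_col //= leqNgt; apply/negP => h.
have := ltn_minval h hc; rewrite minpos_col_of // ltnNge => /negP; apply.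
by rewrite row_ofP //; apply: ltn_trans hc.
Qed.

Lemma col_of_minpos j : j < n -> col_of s (minpos j) = j.
Proof.
move=> hj; have [h1 h2] := minposP hj; have hc := ltn_col_of h1.
have := minpos_col_of h1 h2.
move: (lrmin_pos_sorted) => /(sorted_uniq ltn_trans ltnn) u.
by move/eqP; rewrite nth_uniq // => /eqP.
Qed.

Hypothesis us : uniq s.

(** Since the entries are distinct, equality in [row_ofP] occurs only at the minimum itself; the
    strict form is the one that [in_row] tests. *)
Lemma ltn_minval_nonmin i k :
  k < size s -> ~~ is_lrmin s k -> i < n ->
  (minval i < nth 0 s k) = (row_of s k <= i).
Proof.
move=> hk mk hi; rewrite ltn_neqAle row_ofP //; have [h1 h2] := minposP hi.
by rewrite nth_uniq //; have [h|//] := eqVneq (minpos i) k; rewrite -h h2 in mk.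
Qed.

Lemma ltn_minpos_nonmin j k :
  k < size s -> ~~ is_lrmin s k -> j < n -> (minpos j < k) = (j <= col_of s k).
Proof.
move=> hk mk hj; rewrite ltn_neqAle col_ofP //; have [h1 h2] := minposP hj.
by have [h|//] := eqVneq (minpos j) k; rewrite -h h2 in mk.
Qed.

(** By the strict comparisons, [in_row] asks for the least [i] with [row_of s k <= i] and [in_col]
    for the largest [j] with [j <= col_of s k]. The bounds on [i] and [j] keep [nth] off its default
    value. *)
Lemma in_cellE i j k :
  k < size s -> i < n -> j < n ->
  in_cell s i j k = [&& ~~ is_lrmin s k, row_of s k == i & col_of s k == j].
Proof.
move=> hk hi hj; rewrite /in_cell; have [//|mk] := boolP (is_lrmin s k) => /=.
have hc := ltn_col_of hk; have hr := leq_ltn_trans (leq_row_col hk) hc.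
congr (_ && _); rewrite /in_row /in_col.
  rewrite nth_lrmin_val // ltn_minval_nonmin // size_map.
  apply/andP/eqP => [[h1 /allP h2]|<-].
    apply/eqP; rewrite eqn_leq h1 /=.
    have := h2 (row_of s k); rewrite mem_iota /= => /(_ hr).
    by rewrite nth_lrmin_val // ltn_minval_nonmin // leqnn.
  split=> //; apply/allP => i'; rewrite mem_iota /= => hi'.
  by rewrite nth_lrmin_val // ltn_minval_nonmin //; apply/implyP.
rewrite ltn_minpos_nonmin //.
apply/andP/eqP => [[h1 /allP h2]|<-].
  apply/eqP; rewrite eqn_leq h1 andbT.
  have := h2 (col_of s k); rewrite mem_iota /= => /(_ hc).
  by rewrite ltn_minpos_nonmin // leqnn.
split=> //; apply/allP => j'; rewrite mem_iota /= => hj'.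
by rewrite ltn_minpos_nonmin //; apply/implyP.
Qed.

Lemma leq_row_of_avoid3124 k l :
  ~ contains s [:: 3; 1; 2; 4] -> k < l -> l < size s ->
  ~~ is_lrmin s k -> ~~ is_lrmin s l -> row_of s k <= row_of s l.
Proof.
move=> av hkl hl mk ml; rewrite leqNgt; apply/negP => hr; apply: av.
have hk := ltn_trans hkl hl.
have hck := ltn_col_of hk; have hrk := leq_ltn_trans (leq_row_col hk) hck.
have hrl := ltn_trans hr hrk.
have p1 := ltn_minpos hr hrk; have v1 := ltn_minval hr hrk.
have := ltn_minpos_nonmin hk mk hrk; rewrite leq_row_col // => p2.
have v2 := ltn_minval_nonmin hk mk hrk; rewrite leqnn in v2.
have v3 := row_ofP k hrl.
have v4 := ltn_minval_nonmin hl ml hrl; rewrite leqnn in v4.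
apply: (@contains4 _ (minpos (row_of s l)) (minpos (row_of s k)) k l) => //.
by split=> // -[|[|[|[|i]]]] [|[|[|[|j]]]] //= _ _; lia.
Qed.

Lemma col_of_avoid2314 k l :
  ~ contains s [:: 2; 3; 1; 4] -> k < l -> l < size s ->
  ~~ is_lrmin s k -> ~~ is_lrmin s l -> nth 0 s k < nth 0 s l ->
  col_of s k = col_of s l.
Proof.
move=> av hkl hl mk ml hv; apply/eqP; rewrite eqn_leq leq_col_of ?(ltnW hkl) //=.
rewrite leqNgt; apply/negP => hc; apply: av.
have hk := ltn_trans hkl hl.
have hck := ltn_col_of hk; have hrk := leq_ltn_trans (leq_row_col hk) hck.
have hcl := ltn_col_of hl.
have := ltn_minpos_nonmin hk mk hrk; rewrite leq_row_col // => p1.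
have p2 := col_ofP hk hcl.
have := ltn_minpos_nonmin hl ml hcl; rewrite leqnn => p3.
(* The row of [k] is at most its column, which precedes that of [l]; so the minimum opening the
   column of [l] is below the one bounding the row of [k], and plays the [1]. *)
have v1 := ltn_minval (leq_ltn_trans (leq_row_col hk) hc) hcl.
have v2 := ltn_minval_nonmin hk mk hrk; rewrite leqnn in v2.
apply: (@contains4 _ (minpos (row_of s k)) k (minpos (col_of s l)) l).
  by split => //; lia.
by split=> // -[|[|[|[|i]]]] [|[|[|[|j]]]] //= _ _; lia.
Qed.

End LRMinima.

(** * Lexicographic keys and lists sorted by a key *)

Lemma ltn_lex d a b a' b' : b < d -> b' < d ->
  (a * d + b < a' * d + b') = (a < a') || (a == a') && (b < b').
Proof. by move=> hb hb'; case: (ltngtP a a') => [h|h|->] /=; nia. Qed.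

Lemma eqn_lex d a b a' b' : b < d -> b' < d ->
  (a * d + b == a' * d + b') = (a == a') && (b == b').
Proof. by move=> hb hb'; case: (ltngtP a a') => [h|h|->] /=; nia. Qed.

Lemma count_ltn_iota r n : r <= n -> count (fun j => j < r) (iota 0 n) = r.
Proof.
move=> h; rewrite -[n](subnKC h) iotaD count_cat.
rewrite (@eq_in_count _ _ predT); last by move=> y; rewrite mem_iota /=; lia.
rewrite count_predT size_iota (@eq_in_count _ _ pred0 (iota _ (_ - _))).
  by rewrite count_pred0; lia.
by move=> y; rewrite mem_iota /=; lia.
Qed.

Section KeySorted.

Variables (T : eqType) (key : T -> nat).
Local Notation keyle := (relpre key leq).

Lemma keyle_trans : transitive keyle.
Proof. by move=> y x z; apply: leq_trans. Qed.

(** Each head has the least key of its list and occurs in the other list, so the two keys agree, and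
    the block of that key identifies the heads. Blocks are compared, and not only keys, because the
    entries of one cell will share a key. *)
Lemma eq_from_key_filter s t :
  sorted keyle s -> sorted keyle t ->
  (forall a, [seq x <- s | key x == a] = [seq x <- t | key x == a]) -> s = t.
Proof.
have h0 u : (forall a, [::] = [seq x <- u | key x == a]) -> u = [::].
  by case: u => // x u /(_ (key x)); rewrite /= eqxx.
have mem_filter_key u v : (forall a, [seq x <- u | key x == a] =
    [seq x <- v | key x == a]) -> {subset u <= v}.
  move=> h x hx; have : x \in [seq y <- u | key y == key x].
    by rewrite mem_filter eqxx.
  by rewrite h mem_filter => /andP[].
elim: s t => [|x s IH] [|y t] ss st h //; first by rewrite (h0 (y :: t)).
  by rewrite (h0 (x :: s)).
have hxy : key x = key y.
  have hx : x \in y :: t by apply: (mem_filter_key _ _ h); rewrite mem_head.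
  have hy : y \in x :: s.
    by apply: (@mem_filter_key (y :: t)) => [a|]; rewrite ?h ?mem_head.
  have /allP hs := order_path_min keyle_trans ss.
  have /allP ht := order_path_min keyle_trans st.
  move: hx hy; rewrite !inE => /predU1P[->//|/ht/= h1] /predU1P[->//|/hs/= h2].
  by apply/eqP; rewrite eqn_leq h1 h2.
have := h (key x); rewrite /= eqxx -hxy eqxx => -[exy _].
rewrite -exy in st h *; congr (_ :: _); apply: IH.
- exact: path_sorted ss.
- exact: path_sorted st.
- by move=> a; have := h a; rewrite /=; case: eqP => // _ [].
Qed.

Variables (G : nat -> seq T) (N : nat).
Hypothesis keyG : forall a t, a < N -> t \in G a -> key t = a.
Local Notation L := (flatten [seq G a | a <- iota 0 N]).

Lemma filter_key_flatten a : a < N -> [seq t <- L | key t == a] = G a.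
Proof.
have hlt m b : b < m <= N -> a = b -> [seq t <- G b | key t == a] = G b.
  move=> hb ->; apply/all_filterP/allP => t /keyG ->//; lia.
have hne m b : b < m <= N -> a != b -> [seq t <- G b | key t == a] = [::].
  move=> hb hab; apply/eqP; rewrite -[_ == _]negbK -has_filter; apply/hasPn.
  by move=> t /keyG ->; [rewrite eq_sym | lia].
have h m : m <= N -> [seq t <- flatten [seq G b | b <- iota 0 m] | key t == a] =
    if a < m then G a else [::].
  elim: m => // m IH hm; rewrite -addn1 iotaD map_cat flatten_cat filter_cat.
  rewrite IH; last exact: ltnW.
  rewrite /= cats0 add0n addn1 ltnS; have [e|hne'] := eqVneq a m.
    by rewrite (hlt m.+1) ?ltnSn // e ltnn leqnn.
  rewrite (hne m.+1) ?ltnSn // cats0.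
  by rewrite [a <= m]leq_eqVlt (negbTE hne').
by move=> ha; rewrite h // ha.
Qed.

Lemma sorted_key_flatten : sorted keyle L.
Proof.
have h m : m <= N -> pairwise keyle (flatten [seq G b | b <- iota 0 m]).
  elim: m => // m IH hm; rewrite -addn1 iotaD map_cat flatten_cat pairwise_cat.
  rewrite IH ?(ltnW hm) //= cats0 add0n; apply/andP; split.
    apply/allrelP => x y /flattenP[_ /mapP[b hb ->] hx] hy /=.
    rewrite mem_iota in hb; rewrite (keyG _ hx) ?(keyG _ hy) //; lia.
  have : all (fun t => key t == m) (G m) by apply/allP => t /keyG ->.
  elim: (G m) => //= x u IHu /andP[/eqP ex hu]; rewrite IHu // andbT.
  by apply: sub_all hu => y /eqP ey; rewrite /= ex ey.
by rewrite (sorted_pairwise keyle_trans) h.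
Qed.

Lemma mem_flatten_key t : (t \in L) = (key t < N) && (t \in G (key t)).
Proof.
apply/flattenP/andP => [[_ /mapP[a ha ->] ht]|[h1 h2]].
  by rewrite mem_iota in ha; rewrite (keyG _ ht).
by exists (G (key t)) => //; apply: map_f; rewrite mem_iota.
Qed.

(** The multiplicity of [t] in the whole list is its multiplicity in the block of its own key. *)
Lemma uniq_flatten_key : (forall a, a < N -> uniq (G a)) -> uniq L.
Proof.
move=> uG; apply: count_mem_uniq => t; rewrite mem_flatten_key.
have [ht|ht] := ltnP (key t) N; last first.
  apply/eqP; rewrite -leqn0 leqNgt -has_count has_pred1 mem_flatten_key.
  by rewrite ltnNge ht.
rewrite -count_uniq_mem ?uG // -(filter_key_flatten ht) count_filter.
by apply: eq_count => x /=; case: eqP => [->|]; rewrite ?eqxx.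
Qed.

End KeySorted.

(* The tag [(i, j, x)] stands for the entry [x >= 1] of the cell [(i, j)], and
   [(j, j, 0)] for the [j]-th left-to-right minimum. [tag_pos] orders the tags
   by position: by columns, starting with the minimum, then by rows.
   [tag_val] orders them by value: by rows, starting with the minimum, then by
   columns from right to left, then by [x < M]. *)
Definition etag : Type := (nat * nat * nat)%type.
Definition tag_row (t : etag) : nat := t.1.1.
Definition tag_col (t : etag) : nat := t.1.2.
Definition is_min (t : etag) : bool := t.2 == 0.

Definition tag_pos (n : nat) (t : etag) : nat :=
  tag_col t * n.+1 + (if is_min t then 0 else (tag_row t).+1).

(** Both digits are reversed: larger values lie in higher rows and, within a row, further left. A
    non-minimum has its column below [n], so its second digit is positive and [0] is left to the
    minimum. *)
Definition tag_block (n : nat) (t : etag) : nat :=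
  (n - tag_row t) * n.+1 + (if is_min t then 0 else n - tag_col t).

Definition tag_val (n M : nat) (t : etag) : nat := tag_block n t * M + t.2.

(** Decodes a value of [tag_pos]: the quotient is the column, a remainder [0] stands for its minimum
    and a remainder [i.+1] for the row [i]. *)
Definition tags_at (n : nat) (F : nat -> nat -> seq nat) (a : nat) : seq etag :=
  let j := a %/ n.+1 in
  if a %% n.+1 is i.+1 then [seq (i, j, x) | x <- F i j] else [:: (j, j, 0)].

Definition tags n F : seq etag :=
  flatten [seq tags_at n F a | a <- iota 0 (n * n.+1)].

(** These bounds keep every digit of [tag_pos] and [tag_val] below its radix, so that keys compare
    lexicographically. *)
Definition valid_tag (n M : nat) (t : etag) : bool :=
  [&& tag_row t <= tag_col t, tag_col t < n,
      is_min t ==> (tag_row t == tag_col t) & t.2 < M].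

(** * Comparison of tags by position and by value *)

Section TagOrder.

Variables (n M : nat).
Implicit Types t u : etag.

Lemma leq_tag_pos t u : valid_tag n M t -> valid_tag n M u ->
  (tag_pos n t <= tag_pos n u) = (tag_col t < tag_col u) ||
    (tag_col t == tag_col u) &&
      (is_min t || ~~ is_min u && (tag_row t <= tag_row u)).
Proof.
case/and4P=> h1 h2 h3 h4 /and4P[h5 h6 h7 h8].
rewrite leqNgt /tag_pos ltn_lex; [|by case: is_min; lia..].
by case: (is_min t) h3; case: (is_min u) h7; lia.
Qed.

Lemma eq_tag_pos t u : valid_tag n M t -> valid_tag n M u ->
  (tag_pos n t == tag_pos n u) = (t.1 == u.1) && (is_min t == is_min u).
Proof.
case: t u => [[i j] x] [[k l] y].
case/and4P=> h1 h2 h3 h4 /and4P[h5 h6 h7 h8].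
rewrite /tag_pos eqn_lex; [|by case: is_min; lia..].
move: h1 h2 h3 h5 h6 h7; rewrite -pair_eqE /pair_eq /tag_row /tag_col /=.
by case: is_min; case: is_min; lia.
Qed.

Lemma eq_tag_block t u : valid_tag n M t -> valid_tag n M u ->
  (tag_block n t == tag_block n u) = (t.1 == u.1) && (is_min t == is_min u).
Proof.
case: t u => [[i j] x] [[k l] y].
case/and4P=> h1 h2 h3 h4 /and4P[h5 h6 h7 h8].
rewrite /tag_block eqn_lex; [|by case: is_min; lia..].
move: h1 h2 h3 h5 h6 h7; rewrite -pair_eqE /pair_eq /tag_row /tag_col /=.
by case: is_min; case: is_min; lia.
Qed.

Lemma ltn_tag_block t u : valid_tag n M t -> valid_tag n M u ->
  (tag_block n t < tag_block n u) = (tag_row u < tag_row t) ||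
    (tag_row t == tag_row u) &&
      (~~ is_min u && (is_min t || (tag_col u < tag_col t))).
Proof.
case/and4P=> h1 h2 h3 h4 /and4P[h5 h6 h7 h8].
rewrite /tag_block ltn_lex; [|by case: is_min; lia..].
by case: (is_min t) h3; case: (is_min u) h7; lia.
Qed.

Lemma ltn_tag_val t u : valid_tag n M t -> valid_tag n M u ->
  (tag_val n M t < tag_val n M u) = (tag_block n t < tag_block n u) ||
    (tag_block n t == tag_block n u) && (t.2 < u.2).
Proof. by move=> /and4P[_ _ _ h] /and4P[_ _ _ h']; rewrite /tag_val ltn_lex. Qed.

Lemma tag_val_inj : {in valid_tag n M &, injective (tag_val n M)}.
Proof.
move=> t u ht hu /eqP; have [_ _ _ h] := and4P ht; have [_ _ _ h'] := and4P hu.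
rewrite /tag_val eqn_lex // eq_tag_block // => /andP[/andP[/eqP h1 _] /eqP h2].
by rewrite (surjective_pairing t) h1 h2 -surjective_pairing.
Qed.

End TagOrder.

(** * The word of a filling and its cells *)

Section Tags.

Variables (n M : nat) (F : nat -> nat -> seq nat).
Hypothesis F_stair : forall i j, F i j <> [::] -> i <= j < n.
Hypothesis F_perm : forall i j, is_perm (F i j).
Hypothesis F_size : forall i j, size (F i j) < M.

Local Notation W := (tags n F).
Local Notation w := [seq tag_val n M t | t <- W].
Local Notation t0 := (0, 0, 0).
Local Notation W_ k := (nth t0 W k).

Lemma mem_F i j x : x \in F i j -> [/\ 0 < x, x < M, i <= j & j < n].
Proof.
move=> hx; have /andP[h1 h2] : i <= j < n by apply: F_stair => h; rewrite h in hx.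
have := F_size i j; move: hx; rewrite (mem_is_perm _ (F_perm i j)) => /andP[].
by move=> h3 h4 h5; split=> //; apply: leq_ltn_trans h5.
Qed.

Lemma bound_gt0 : 0 < M. Proof. exact: leq_ltn_trans (F_size 0 0). Qed.

Lemma tags_at_pos a t : t \in tags_at n F a -> tag_pos n t = a.
Proof.
rewrite /tags_at; case er: (a %% n.+1) => [|i].
  by rewrite inE => /eqP->; rewrite /tag_pos /= [RHS](divn_eq a n.+1) er.
case/mapP=> x /mem_F[hx _ _ _] ->.
rewrite /tag_pos /is_min /= [RHS](divn_eq a n.+1) er.
by case: x hx.
Qed.

Lemma tags_at_min j : tags_at n F (tag_pos n (j, j, 0)) = [:: (j, j, 0)].
Proof. by rewrite /tags_at /tag_pos /= addn0 modnMl mulnK. Qed.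

Lemma tags_at_cell i j x : i < n -> 0 < x ->
  tags_at n F (tag_pos n (i, j, x)) = [seq (i, j, x) | x <- F i j].
Proof.
case: x => // x hi _; rewrite /tags_at /tag_pos /is_min /= modnMDl modn_small //.
by rewrite divnMDl // divn_small // addn0.
Qed.

Lemma mem_tags t : (t \in W) =
  (valid_tag n M t) && (is_min t || (t.2 \in F (tag_row t) (tag_col t))).
Proof.
rewrite (mem_flatten_key (key := tag_pos n)); last by move=> a u _; apply: tags_at_pos.
case: t => [[i j] x]; rewrite /valid_tag /tag_row /tag_col /=.
case: x => [|x] /=.
  rewrite /tag_pos /tags_at /= addn0 modnMl mulnK //= ltn_pmul2r // inE.
  rewrite !xpair_eqE !eqxx !andbT.
  rewrite bound_gt0; case: eqVneq => [->|_] /=; last by rewrite !andbF.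
  by rewrite leqnn !andbT.
rewrite /is_min /=; apply/andP/andP => [[_]|[/and3P[h1 h2 h3] h4]].
  rewrite /tags_at; case er: (_ %% n.+1) => [|i']; first by rewrite inE xpair_eqE andbF.
  case/mapP=> y hy [ei ej ey].
  rewrite -ei -ej -ey in hy; have := mem_F hy; rewrite hy.
  by case=> _ -> -> ->.
rewrite tags_at_cell //; last exact: leq_ltn_trans h2.
rewrite map_f //; split=> //; rewrite /tag_pos /is_min /= /tag_row /tag_col /=.
nia.
Qed.

Lemma sorted_tags : sorted (relpre (tag_pos n) leq) W.
Proof. by apply: sorted_key_flatten => a t _; apply: tags_at_pos. Qed.

Lemma filter_tags a : a < n * n.+1 ->
  [seq t <- W | tag_pos n t == a] = tags_at n F a.
Proof. by apply: filter_key_flatten => b t _; apply: tags_at_pos. Qed.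

Lemma uniq_tags : uniq W.
Proof.
apply: (uniq_flatten_key (key := tag_pos n)) => [a t _|a _].
  exact: tags_at_pos.
rewrite /tags_at; case: (_ %% _) => // i; rewrite map_inj_uniq.
  exact: is_perm_uniq.
by move=> x y [].
Qed.

Lemma valid_nth_tags k : k < size W -> valid_tag n M (W_ k).
Proof. by move=> /(mem_nth t0); rewrite mem_tags => /andP[]. Qed.

Lemma uniq_word : uniq w.
Proof.
rewrite map_inj_in_uniq ?uniq_tags // => t u; rewrite !mem_tags.
by move=> /andP[ht _] /andP[hu _]; apply: tag_val_inj.
Qed.

Lemma leq_tag_pos_nth k l : k <= l -> l < size W ->
  tag_pos n (W_ k) <= tag_pos n (W_ l).
Proof.
move=> hkl hl.
apply: (sorted_leq_nth (@keyle_trans _ (tag_pos n)) (fun x => leqnn _) t0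
          sorted_tags) => //.
by rewrite inE; apply: leq_ltn_trans hl.
Qed.

Lemma nth_word k : k < size W -> nth 0 w k = tag_val n M (W_ k).
Proof. by move=> hk; rewrite (nth_map t0). Qed.

(** The minimum of a column opens it and is smaller than every other entry there, as rows are at
    most columns. Conversely, anything before this minimum lies in an earlier column, hence in a
    higher row, and is larger. *)
Lemma is_lrmin_word k : k < size W -> is_lrmin w k = is_min (W_ k).
Proof.
move=> hk; have vk := valid_nth_tags hk.
apply/is_lrminP/idP => [h|mk l hl].
  apply: contraT => mk; case/and4P: (vk) => h1 h2 _ _.
  (* The minimum opening the column of [k] is the earlier, smaller entry. *)
  pose c := tag_col (W_ k); have hc : (c, c, 0) \in W.
    by rewrite mem_tags /valid_tag /tag_row /tag_col /= h2 leqnn eqxx bound_gt0.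
  have vc : valid_tag n M (c, c, 0) by move: hc; rewrite mem_tags => /andP[].
  have hi : index (c, c, 0) W < size W by rewrite index_mem.
  have hlt : index (c, c, 0) W < k.
    rewrite ltnNge; apply/negP => hle; have := leq_tag_pos_nth hle hi.
    rewrite nth_index // (leq_tag_pos vk vc) /= /tag_col /= -/c ltnn eqxx.
    by rewrite (negbTE mk).
  have := h _ hlt; rewrite !nth_word // nth_index // (ltn_tag_val vk vc).
  rewrite (ltn_tag_block vk vc) (eq_tag_block vk vc) -/c /= {1 2}/tag_row /=.
  rewrite (negbTE mk) andbF /=; case/orP; rewrite ?andbF ?orbF //.
  by move: h1; rewrite -/c leqNgt => /negbTE ->.
have hlW := ltn_trans hl hk; have vl := valid_nth_tags hlW.
have := leq_tag_pos_nth (ltnW hl) hk; rewrite (leq_tag_pos vl vk) mk /= orbF.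
have hne : W_ l <> W_ k.
  by move/eqP; rewrite nth_uniq ?uniq_tags // => /eqP e; rewrite e ltnn in hl.
rewrite !nth_word // (ltn_tag_val vk vl) (ltn_tag_block vk vl) mk /=.
move: vl vk mk hne; rewrite /valid_tag /tag_row /tag_col /is_min.
case: (W_ l) => [[i j] x]; case: (W_ k) => [[i' j'] x'] /= vl vk mk hne hc.
have [e|hii] := eqVneq i' i; last by apply/orP; left; lia.
case: x vl hne hc => [|x] vl hne hc; last by lia.
case: hne; congr (_, _, _); lia.
Qed.

(** Rows and columns are counts over [lrmin_pos]; through this list they become counts over
    [iota 0 n]. *)
Lemma lrmin_tags :
  [seq W_ k | k <- lrmin_pos w] = [seq (j, j, 0) | j <- iota 0 n].
Proof.
have -> : [seq W_ k | k <- lrmin_pos w] = [seq t <- W | is_min t].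
  rewrite -{3}(map_nth_iota_size t0 W) filter_map; congr map.
  rewrite /lrmin_pos size_map; apply: eq_in_filter => k; rewrite mem_iota /=.
  exact: is_lrmin_word.
apply: (eq_from_key_filter (key := tag_pos n)).
- exact: (sorted_filter (@keyle_trans _ _) _ sorted_tags).
- rewrite sorted_map; apply: sub_sorted (iota_ltn_sorted 0 n) => i j hij.
  by rewrite /= /tag_pos /= /tag_col /= leq_add2r leq_mul2r ltnW ?orbT.
move=> a.
(* Either [a] is the key of a minimum, and both blocks are that single tag, or no minimum has key
   [a] and both blocks are empty. *)
have [[j hj ->]|hno] := pselect (exists2 j, j < n & a = tag_pos n (j, j, 0)).
  rewrite -filter_predI (eq_filter (a2 := predI is_min
    (fun t => tag_pos n t == tag_pos n (j, j, 0)))); last first.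
    by move=> t /=; rewrite andbC.
  rewrite filter_predI filter_tags; last first.
    by rewrite /tag_pos /= addn0 ltn_pmul2r.
  rewrite tags_at_min /= filter_map.
  rewrite (eq_filter (a2 := pred1 j)); last first.
    by move=> i /=; rewrite /tag_pos /= !addn0 eqn_pmul2r.
  by rewrite filter_pred1_uniq ?iota_uniq ?mem_iota.
have h0 (L : seq etag) : (forall t, t \in L -> is_min t && valid_tag n M t) ->
    [seq t <- L | tag_pos n t == a] = [::].
  move=> hL; apply/eqP; rewrite -[_ == _]negbK -has_filter; apply/hasPn.
  move=> t /hL; case: t => [[i j] x]; rewrite /valid_tag /tag_row /tag_col /=.
  case/andP=> /eqP /= -> /and4P[_ hj /eqP-> _]; apply/eqP => e; apply: hno.
  by exists j.
rewrite !h0 // => [t /mapP[j]|t].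
  rewrite mem_iota => /= hj ->; rewrite /valid_tag /tag_row /tag_col /=.
  by rewrite leqnn hj eqxx bound_gt0.
by rewrite mem_filter mem_tags => /andP[-> /andP[-> _]].
Qed.

Lemma size_lrmin_word : size (lrmin_pos w) = n.
Proof. by have /(congr1 size) := lrmin_tags; rewrite !size_map size_iota. Qed.

Lemma row_of_word k : k < size W -> row_of w k = tag_row (W_ k).
Proof.
move=> hk; have vk := valid_nth_tags hk; rewrite /row_of /lrmin_val count_map.
have hr : tag_row (W_ k) <= n.
  by case/and4P: vk => h1 h2 _ _; apply: leq_trans h1 (ltnW h2).
rewrite -[RHS](count_ltn_iota hr).
rewrite (@eq_in_count _ _ (preim (nth t0 W)
   (fun t => tag_val n M (W_ k) < tag_val n M t))); last first.
  move=> l; rewrite lrmin_posP size_map => /andP[hl _] /=.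
  by rewrite !nth_word.
rewrite -count_map lrmin_tags count_map; apply: eq_in_count => j.
rewrite mem_iota /= => hj.
have vj : valid_tag n M (j, j, 0).
  by rewrite /valid_tag /tag_row /tag_col /= leqnn hj eqxx bound_gt0.
by rewrite (ltn_tag_val vk vj) (ltn_tag_block vk vj) ltn0 !andbF !orbF.
Qed.

Lemma col_of_word k : k < size W -> col_of w k = tag_col (W_ k).
Proof.
move=> hk; have vk := valid_nth_tags hk; rewrite /col_of.
have hc : (tag_col (W_ k)).+1 <= n by case/and4P: vk.
rewrite -[RHS]/((tag_col (W_ k)).+1.-1) -[in RHS](count_ltn_iota hc).
congr (_.-1).
rewrite (@eq_in_count _ _ (preim (nth t0 W)
   (fun t => tag_col t <= tag_col (W_ k)))); last first.
  move=> l; rewrite lrmin_posP size_map => /andP[hl].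
  rewrite is_lrmin_word // => ml; have vl := valid_nth_tags hl.
  rewrite /=; have [hlk|hkl] := leqP l k.
    have := leq_tag_pos_nth hlk hk; rewrite (leq_tag_pos vl vk).
    by case/orP=> [/ltnW-> | /andP[/eqP-> _]]; rewrite ?leqnn.
  (* If a minimum after [k] were in the same column, [k] would carry that same tag, but tags do not
     repeat. *)
  have := leq_tag_pos_nth (ltnW hkl) hl; rewrite (leq_tag_pos vk vl) ml /= orbF.
  have [h|h] := ltnP (tag_col (W_ k)) (tag_col (W_ l)); first by [].
  case/andP=> [/eqP ec mk]; have : W_ k = W_ l.
    move: ec mk ml vk vl; rewrite /valid_tag /is_min /tag_row /tag_col.
    case: (W_ k) => [[i j] x]; case: (W_ l) => [[i' j'] x'] /= -> /eqP-> /eqP->.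
    by case/and4P=> _ _ /eqP-> _ /and4P[_ _ /eqP-> _].
  move/eqP; rewrite nth_uniq ?uniq_tags // => /eqP e.
  by rewrite e ltnn in hkl.
rewrite -count_map lrmin_tags count_map; apply: eq_in_count => j.
by rewrite mem_iota.
Qed.

Lemma same_order_cell i j :
  same_order [seq tag_val n M (i, j, x) | x <- F i j] (F i j).
Proof.
apply: same_order_map => x y /mem_F[hx _ _ _] /mem_F[hy _ _ _].
rewrite /tag_val /tag_block /is_min /tag_row /tag_col /=.
by case: x hx => // x _; case: y hy => // y _; rewrite ltn_add2l.
Qed.

Lemma cell_word i j : i <= j < n ->
  standardize [seq nth 0 w k | k <- iota 0 (size w) & in_cell w i j k] = F i j.
Proof.
case/andP=> hij hj; have hi := leq_ltn_trans hij hj.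
(* Any positive third component names the cell, since [tag_pos] only tests whether it is [0]; [1] is
   the representative used. *)
rewrite (@eq_in_filter _ _ (preim (nth t0 W)
   (fun t => tag_pos n t == tag_pos n (i, j, 1)))); last first.
  move=> k; rewrite mem_iota /= => hk.
  rewrite in_cellE ?size_lrmin_word // ?uniq_word //; rewrite size_map in hk.
  rewrite is_lrmin_word // row_of_word // col_of_word //.
  have /and4P[h1 h2 h3 h4] := valid_nth_tags hk.
  have hr := leq_ltn_trans h1 h2; rewrite /tag_pos eqn_lex //; last by case: is_min.
  rewrite [tag_col (i, j, 1)]/tag_col [tag_row (i, j, 1)]/tag_row /=.
  by case: (is_min _); rewrite /= ?andbF // eqSS andbC.
rewrite (@eq_in_map _ _ _ (fun k => tag_val n M (W_ k)) _).1; last first.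
  move=> k; rewrite mem_filter mem_iota size_map => /andP[_] /= hk.
  exact: nth_word.
rewrite (map_comp (tag_val n M)) size_map -filter_map map_nth_iota_size.
rewrite filter_tags; last first.
  by rewrite /tag_pos /is_min /= /tag_row /tag_col /=; nia.
rewrite tags_at_cell // -map_comp -[RHS]standardize_id //.
exact/eq_standardize/same_order_cell.
Qed.

End Tags.

(** * Pattern occurrences in the word of a chain of cells *)

Section Chain.

Variables (n M : nat) (F : nat -> nat -> seq nat).
Hypothesis F_stair : forall i j, F i j <> [::] -> i <= j < n.
Hypothesis F_perm : forall i j, is_perm (F i j).
Hypothesis F_size : forall i j, size (F i j) < M.
Hypothesis F_chain : forall i j k l,
  F i j <> [::] -> F k l <> [::] -> ~~ ((k < i) && (j < l)).

Local Notation W := (tags n F).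
Local Notation w := [seq tag_val n M t | t <- W].
Local Notation t0 := (0, 0, 0).
Local Notation W_ k := (nth t0 W k).
Local Notation w_ k := (nth 0 w k).

Let valid k : k < size W -> valid_tag n M (W_ k).
Proof. exact: valid_nth_tags. Qed.

Lemma nonmin_after k l :
  k < l -> l < size W -> w_ k < w_ l -> ~~ is_min (W_ l).
Proof.
move=> hkl hl hv; rewrite -(is_lrmin_word F_stair F_perm F_size) //.
by apply/negP => /is_lrminP/(_ _ hkl); rewrite ltnNge ltnW.
Qed.

Lemma nonmin_nth_F k :
  k < size W -> ~~ is_min (W_ k) -> F (tag_row (W_ k)) (tag_col (W_ k)) <> [::].
Proof.
move=> hk /negbTE mk; have := mem_nth t0 hk.
rewrite (mem_tags F_stair F_perm F_size) mk => /andP[_] /=.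
by case: (F _ _).
Qed.

(** Being earlier, [k] has a smaller column, or the same one and a row index at most that of [l];
    being smaller, it has a lower row, or the same one and a column at least that of [l]. [F_chain]
    forbids an earlier column with a lower row, and only the same cell remains. *)
Lemma ascent_same_cell k l :
  k < l -> l < size W -> ~~ is_min (W_ k) -> ~~ is_min (W_ l) ->
  w_ k < w_ l -> (W_ k).1 = (W_ l).1.
Proof.
move=> hkl hl mk ml; have hk := ltn_trans hkl hl.
have := leq_tag_pos_nth F_stair F_perm F_size (ltnW hkl) hl.
have := F_chain (nonmin_nth_F hk mk) (nonmin_nth_F hl ml).
have vk := valid hk; have vl := valid hl.
rewrite (leq_tag_pos vk vl) !nth_word // (ltn_tag_val vk vl).
rewrite (ltn_tag_block vk vl) (eq_tag_block vk vl) (negbTE mk) (negbTE ml) /=.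
rewrite /tag_row /tag_col; case: (W_ k).1 (W_ l).1 => [i j] [i' j'] /=.
rewrite xpair_eqE => h1 h2 h3; congr (_, _); lia.
Qed.

(** The entries of a cell share [tag_pos], which is monotone along the word: a cell is an interval
    of positions. *)
Lemma same_cell_pos k l m :
  k <= l -> l <= m -> m < size W -> ~~ is_min (W_ k) -> ~~ is_min (W_ m) ->
  (W_ k).1 = (W_ m).1 -> ~~ is_min (W_ l) /\ (W_ l).1 = (W_ m).1.
Proof.
move=> hkl hlm hm mk mm e.
have hl := leq_ltn_trans hlm hm; have hk := leq_ltn_trans hkl hl.
have h1 := leq_tag_pos_nth F_stair F_perm F_size hkl hl.
have h2 := leq_tag_pos_nth F_stair F_perm F_size hlm hm.
have : tag_pos n (W_ k) == tag_pos n (W_ m).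
  by rewrite (eq_tag_pos (valid hk) (valid hm)) e eqxx (negbTE mk) (negbTE mm).
move/eqP => e'; rewrite e' in h1.
have : tag_pos n (W_ l) == tag_pos n (W_ m) by rewrite eqn_leq h1 h2.
rewrite (eq_tag_pos (valid hl) (valid hm)) (negbTE mm) => /andP[/eqP-> /eqP->].
by [].
Qed.

(** The entries of a cell share [tag_block], the leading digit of the value: a cell is an interval
    of values. *)
Lemma same_cell_val k l m :
  k < size W -> l < size W -> m < size W -> w_ k < w_ l -> w_ l < w_ m ->
  ~~ is_min (W_ k) -> ~~ is_min (W_ m) -> (W_ k).1 = (W_ m).1 ->
  ~~ is_min (W_ l) /\ (W_ l).1 = (W_ m).1.
Proof.
move=> hk hl hm hkl hlm mk mm e.
have block_le t u : valid_tag n M t -> valid_tag n M u ->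
    tag_val n M t < tag_val n M u -> tag_block n t <= tag_block n u.
  by move=> vt vu; rewrite (ltn_tag_val vt vu) => /orP[/ltnW|/andP[/eqP->]].
rewrite !nth_word // in hkl hlm.
have h1 := block_le _ _ (valid hk) (valid hl) hkl.
have h2 := block_le _ _ (valid hl) (valid hm) hlm.
have : tag_block n (W_ k) == tag_block n (W_ m).
  by rewrite (eq_tag_block (valid hk) (valid hm)) e eqxx (negbTE mk) (negbTE mm).
move/eqP => e'; rewrite e' in h1.
have : tag_block n (W_ l) == tag_block n (W_ m) by rewrite eqn_leq h1 h2.
rewrite (eq_tag_block (valid hl) (valid hm)) (negbTE mm) => /andP[/eqP-> /eqP->].
by [].
Qed.

(** Filtering [W] by the key of the cell gives the tags of [F i j] in order, so an occurrence whose
    tags all have this key is an occurrence in [F i j]. *)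
Lemma contains_cell i j ks q :
  ks != [::] -> sorted ltn ks -> all (fun k => k < size W) ks ->
  (forall k, k \in ks -> ~~ is_min (W_ k) /\ (W_ k).1 = (i, j)) ->
  same_order [seq w_ k | k <- ks] q -> contains (F i j) q.
Proof.
move=> ks0 sks hks hcell hq; have hks' := allP hks.
have [k0 hk0] : exists k0, k0 \in ks.
  by case: ks ks0 {sks hks hcell hq hks'} => // k ks _; exists k; rewrite mem_head.
have vij k : k \in ks -> i <= j < n.
  move=> hk; have [mk e] := hcell _ hk; apply: F_stair.
  by have := nonmin_nth_F (hks' _ hk) mk; rewrite /tag_row /tag_col e.
have /andP[hij hj] := vij _ hk0; have hi := leq_ltn_trans hij hj.
apply: (contains_same_order (same_order_cell F_stair F_perm F_size i j)).
exists [seq w_ k | k <- ks] => //.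
rewrite (@eq_in_map _ _ _ (fun k => tag_val n M (W_ k)) _).1; last first.
  by move=> k /hks' hk; apply: nth_word.
rewrite (map_comp (tag_val n M) (nth t0 W)) (map_comp (tag_val n M) (pair (i, j))).
apply: map_subseq.
rewrite -(tags_at_cell F j hi (ltn0Sn 0))
  -(filter_tags F_stair F_perm F_size); last first.
  by rewrite /tag_pos /is_min /= /tag_row /tag_col /=; nia.
rewrite subseq_filter subseq_map_nth // andbT; apply/allP => _ /mapP[k hk ->].
have [mk e] := hcell _ hk.
by rewrite /tag_pos (negbTE mk) /tag_row /tag_col e.
Qed.

Lemma word_avoid2314 :
  contains w [:: 2; 3; 1; 4] -> exists i j, contains (F i j) [:: 2; 3; 1; 4].
Proof.
case/containsP=> ks [sks hks] hq; have [sz H] := hq.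
case: ks sz sks hks hq H => [|a [|b [|c [|d [|? ?]]]]] // _ /=.
rewrite size_map => /and4P[ab bc cd _] /and5P[ha hb hc hd _] hq H.
have vab := H 0 1 isT isT; have vca := H 2 0 isT isT; have vbd := H 1 3 isT isT.
rewrite /= in vab vca vbd.
have mb := nonmin_after ab hb vab.
have md := nonmin_after (ltn_trans bc cd) hd vbd.
(* The entries playing [3] and [4] form an ascent; [1] lies between them in position, and then [2]
   lies between [1] and [3] in value. *)
have ebd := ascent_same_cell (ltn_trans bc cd) hd mb md vbd.
have [mc ecd] := same_cell_pos (ltnW bc) (ltnW cd) hd mb md ebd.
have [ma eab] := same_cell_val hc ha hb vca vab mc mb (etrans ecd (esym ebd)).
exists (W_ d).1.1, (W_ d).1.2.
apply: (@contains_cell _ _ [:: a; b; c; d]) => //=;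
  rewrite ?ab ?bc ?cd ?ha ?hb ?hc ?hd //.
by move=> k; rewrite !inE -surjective_pairing => /or4P[] /eqP-> //; rewrite eab ebd.
Qed.

Lemma word_avoid3124 :
  contains w [:: 3; 1; 2; 4] -> exists i j, contains (F i j) [:: 3; 1; 2; 4].
Proof.
case/containsP=> ks [sks hks] hq; have [sz H] := hq.
case: ks sz sks hks hq H => [|a [|b [|c [|d [|? ?]]]]] // _ /=.
rewrite size_map => /and4P[ab bc cd _] /and5P[ha hb hc hd _] hq H.
have vbc := H 1 2 isT isT; have vcd := H 2 3 isT isT; have vad := H 0 3 isT isT.
have vca := H 2 0 isT isT.
rewrite /= in vbc vcd vad vca.
have mc := nonmin_after bc hc vbc.
have md := nonmin_after cd hd vcd.
(* The entries playing [2] and [4] form an ascent; [3] lies between them in value, and then [1] lies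
   between [3] and [2] in position. *)
have ecd := ascent_same_cell cd hd mc md vcd.
have [ma ead] := same_cell_val hc ha hd vca vad mc md ecd.
have [mb ebc] := same_cell_pos (ltnW ab) (ltnW bc) hc ma mc (etrans ead (esym ecd)).
exists (W_ d).1.1, (W_ d).1.2.
apply: (@contains_cell _ _ [:: a; b; c; d]) => //=;
  rewrite ?ab ?bc ?cd ?ha ?hb ?hc ?hd //.
by move=> k; rewrite !inE -surjective_pairing => /or4P[] /eqP-> //; rewrite ebc ecd.
Qed.

(** Cut the copy of [p] at its first entry outside the initial cell. Indecomposability provides an
    ascent across the cut. Its ends share a cell, which also contains the entry at the cut by
    [same_cell_pos]; but the left end is still in the initial cell. *)
Lemma word_avoid_one_plus p :
  is_perm p -> p <> [::] -> skew_indecomposable p ->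
  contains w (direct_sum [:: 1] p) -> exists i j, contains (F i j) p.
Proof.
move=> pp p0 ip /containsP[[|k0 ks] [sks hks] hq]; first by case: hq.
rewrite size_map in hks.
have [/allP hgt hso] := same_order_consE hq pp.
case/andP: hks => hk0 hks; have hks' := allP hks.
have k0lt := allP (order_path_min ltn_trans sks).
have {}sks := path_sorted sks.
(* The smaller entry playing the leading [1] precedes the whole copy of [p]. *)
have mks k : k \in ks -> ~~ is_min (W_ k).
  move=> hk; apply: (nonmin_after (k0lt _ hk)); first exact: hks'.
  exact/hgt/map_f.
have szp : size ks = size p by case: hso; rewrite size_map.
pose P := fun k => (W_ k).1 != (W_ (head 0 ks)).1.
have ks_gt0 : 0 < size ks by rewrite szp; case: (p) p0.
have [hP|hP] := boolP (has P ks); last first.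
  exists (W_ (head 0 ks)).1.1, (W_ (head 0 ks)).1.2.
  apply: (contains_cell _ sks hks _ hso); first by case: (ks) ks_gt0.
  move=> k hk; split; first exact: mks.
  rewrite -surjective_pairing; apply/eqP/negPn.
  by move/hasPn: hP; apply.
have hm : 0 < find P ks < size p.
  rewrite -szp -has_find hP andbT; case: (ks) ks_gt0 @P {hP} => // k ks' _ P /=.
  by rewrite /P /= eqxx.
have hfind := nth_find 0 hP; rewrite {1}/P in hfind.
case: (skew_indecomposable_split pp ip hm) => i j /andP[him hmj] hjp.
have hip := leq_ltn_trans (ltnW (leq_trans him hmj)) hjp.
have hmp := leq_ltn_trans hmj hjp.
have [_ Hord] := hso; rewrite size_map szp in Hord.
rewrite -Hord // !(nth_map 0) ?szp // ltnNge leq_eqVlt; apply/negP.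
rewrite nth_uniq ?size_map ?(uniq_word F_stair F_perm F_size) //;
  try by apply: hks'; rewrite mem_nth ?szp.
have lt_ks a b : a < b -> b < size p -> nth 0 ks a < nth 0 ks b.
  move=> hab hb; apply: (sorted_ltn_nth ltn_trans 0 sks) => //;
  by rewrite inE szp // (ltn_trans hab).
have hij := leq_trans him hmj.
case/orP=> [/eqP e|hv]; first by have := lt_ks _ _ hij hjp; rewrite e ltnn.
have in_ks a : a < size p -> nth 0 ks a \in ks by move=> ha; rewrite mem_nth ?szp.
have eij : (W_ (nth 0 ks i)).1 = (W_ (nth 0 ks j)).1.
  by apply: (ascent_same_cell (lt_ks _ _ hij hjp)); rewrite ?hks' ?mks ?in_ks.
have [_ emj] : ~~ is_min (W_ (nth 0 ks (find P ks))) /\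
    (W_ (nth 0 ks (find P ks))).1 = (W_ (nth 0 ks j)).1.
  apply: (same_cell_pos (k := nth 0 ks i)); rewrite ?hks' ?mks ?in_ks //.
    exact/ltnW/lt_ks.
  have [->//|hne] := eqVneq (find P ks) j.
  by apply/ltnW/lt_ks => //; rewrite ltn_neqAle hne.
case/negP: hfind; rewrite emj -eij; have := before_find 0 him.
by rewrite /P => /negbFE.
Qed.

End Chain.

(** * Words of fillings of the staircase *)

Section Filling.

Variables (n : nat) (f : filling n).

(** Extends the filling by empty words to all pairs of natural numbers, so that tags need not carry
    membership proofs. *)
Definition fill_at (i j : nat) : seq nat :=
  if [pick c : cell n | (row c == i) && (col c == j)] is Some c then f c
  else [::].

(** The successor makes it exceed every cell size, hence every entry when the cells hold
    permutations, as the radix of [tag_val] must. *)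
Definition fill_bound : nat := (\max_(c : cell n) size (f c)).+1.

(** Its values may leave gaps; only their relative order matters, and they are standardized at the
    end. *)
Definition fill_word : seq nat :=
  [seq tag_val n fill_bound t | t <- tags n fill_at].

Lemma cell_inj (c d : cell n) : row c = row d -> col c = col d -> c = d.
Proof.
move=> hr hc; apply: val_inj; apply/eqP; rewrite -pair_eqE; apply/andP.
by split; apply/eqP/val_inj.
Qed.

Lemma row_le_col (c : cell n) : row c <= col c < n.
Proof. by rewrite (valP c) ltn_ord. Qed.

Lemma fill_at_cell (c : cell n) : fill_at (row c) (col c) = f c.
Proof.
rewrite /fill_at; case: pickP => [d /andP[/eqP h1 /eqP h2]|/(_ c)].
  by rewrite (cell_inj h1 h2).
by rewrite !eqxx.
Qed.

Lemma cell_exists i j : i <= j < n -> exists c : cell n, row c = i /\ col c = j.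
Proof.
case/andP=> hij hj; have hi := leq_ltn_trans hij hj.
by exists (exist _ (Ordinal hi, Ordinal hj) hij).
Qed.

Lemma fill_at_neq0 i j :
  fill_at i j <> [::] -> exists c, [/\ row c = i, col c = j & f c <> [::]].
Proof.
rewrite /fill_at; case: pickP => // c /andP[/eqP h1 /eqP h2] h.
by exists c.
Qed.

Lemma fill_at_stair i j : fill_at i j <> [::] -> i <= j < n.
Proof. by case/fill_at_neq0=> c [<- <- _]; apply: row_le_col. Qed.

Lemma fill_at_size i j : size (fill_at i j) < fill_bound.
Proof.
rewrite ltnS /fill_at; case: pickP => // c _.
exact: leq_bigmax.
Qed.

Lemma fill_at_perm : (forall c, is_perm (f c)) -> forall i j, is_perm (fill_at i j).
Proof. by move=> h i j; rewrite /fill_at; case: pickP. Qed.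

Lemma SE_fill_word : (forall c, is_perm (f c)) -> SE n fill_word = f.
Proof.
move=> h; apply/ffunP => c; rewrite ffunE -[RHS]fill_at_cell.
apply: (cell_word fill_at_stair (fill_at_perm h) fill_at_size).
exact: row_le_col.
Qed.

End Filling.

(** * Invariance of the encoding under order isomorphism *)

Section SameOrderSE.

Variables s t : seq nat.
Hypothesis hst : same_order s t.

Lemma is_lrmin_same_order k : k < size s -> is_lrmin s k = is_lrmin t k.
Proof.
move=> hk; apply: eq_in_all => j; rewrite mem_iota /= => hj.
by apply: (proj2 hst) => //; apply: ltn_trans hk.
Qed.

Lemma lrmin_pos_same_order : lrmin_pos s = lrmin_pos t.
Proof.
rewrite /lrmin_pos -(proj1 hst); apply: eq_in_filter => k.
by rewrite mem_iota; apply: is_lrmin_same_order.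
Qed.

Lemma row_of_same_order k : k < size s -> row_of s k = row_of t k.
Proof.
move=> hk; rewrite /row_of /lrmin_val !count_map -lrmin_pos_same_order.
apply: eq_in_count => p; rewrite lrmin_posP => /andP[hp _].
exact: (proj2 hst).
Qed.

Lemma SE_same_order n :
  uniq s -> uniq t -> size (lrmin_pos s) = n -> SE n s = SE n t.
Proof.
move=> us ut hn; apply/ffunP => c; rewrite !ffunE; apply: eq_standardize.
have /andP[hrc hc] := row_le_col c; have hr := leq_ltn_trans hrc hc.
have hn' : size (lrmin_pos t) = n by rewrite -lrmin_pos_same_order.
rewrite -(proj1 hst) (@eq_in_filter _ _ (in_cell t (row c) (col c))).
  apply: same_order_map_nth => //; apply/allP => k.
  by rewrite mem_filter mem_iota => /andP[].
move=> k; rewrite mem_iota /= => hk.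
rewrite !in_cellE ?hn ?hn' // -?(proj1 hst) // is_lrmin_same_order //.
by rewrite row_of_same_order // /col_of lrmin_pos_same_order.
Qed.

End SameOrderSE.

(** * Properties of the encoding and recovery of a word from it *)

Section Encode.

Variables (n : nat) (s : seq nat).
Hypothesis us : uniq s.
Hypothesis sn : size (lrmin_pos s) = n.

Local Notation cellpos i j := [seq k <- iota 0 (size s) | in_cell s i j k].
Local Notation cellword i j := [seq nth 0 s k | k <- cellpos i j].

Lemma mem_cellpos i j k : i < n -> j < n -> (k \in cellpos i j) =
  [&& k < size s, ~~ is_lrmin s k, row_of s k == i & col_of s k == j].
Proof.
move=> hi hj; rewrite mem_filter mem_iota /= add0n andbC.
by have [hk|//] := ltnP k (size s); rewrite in_cellE ?sn.
Qed.

Lemma cellword_uniq i j : uniq (cellword i j).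
Proof.
rewrite map_inj_in_uniq ?filter_uniq ?iota_uniq // => k l.
rewrite !mem_filter !mem_iota /= => /andP[_ hk] /andP[_ hl] /eqP.
by rewrite nth_uniq // => /eqP.
Qed.

Lemma SE_perm c : is_perm (SE n s c).
Proof. by rewrite ffunE; apply/is_perm_standardize/cellword_uniq. Qed.

Lemma SE_active c : SE n s c <> [::] ->
  exists k, [/\ k < size s, ~~ is_lrmin s k, row_of s k = row c & col_of s k = col c].
Proof.
have /andP[hrc hc] := row_le_col c; have hr := leq_ltn_trans hrc hc.
rewrite ffunE => h; have : cellpos (row c) (col c) != [::].
  by apply/eqP => e; apply: h; rewrite e.
case e: (cellpos _ _) => [//|k ks] _; exists k.
have : k \in cellpos (row c) (col c) by rewrite e mem_head.
by rewrite mem_cellpos // => /and4P[-> -> /eqP-> /eqP->].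
Qed.

Lemma SE_contains c q : contains (SE n s c) q -> contains s q.
Proof.
rewrite ffunE => /(contains_same_order (standardize_same_order _)).
apply: contains_subseq; apply: subseq_map_nth.
  exact: (sorted_filter ltn_trans _ (iota_ltn_sorted _ _)).
by apply/allP => k; rewrite mem_filter mem_iota => /andP[].
Qed.

(* The left-to-right minimum bounding the row of the cell lies below and to
   the left of the whole cell, hence plays the role of the 1. *)
Lemma SE_contains_one_plus c p :
  is_perm p -> contains (SE n s c) p -> contains s (direct_sum [:: 1] p).
Proof.
have /andP[hrc hc] := row_le_col c; have hr := leq_ltn_trans hrc hc.
rewrite ffunE => pp /(contains_same_order (standardize_same_order _)).
case=> t /subseqP[m _ ->] {t}; rewrite -map_mask => hso.
set ks := mask m _ in hso.
have hsub : subseq ks (cellpos (row c) (col c)) by apply: mask_subseq.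
have hks k : k \in ks -> [&& k < size s, ~~ is_lrmin s k,
    row_of s k == row c & col_of s k == col c].
  by move/(mem_subseq hsub); rewrite mem_cellpos.
have sks : sorted ltn ks.
  apply: (subseq_sorted ltn_trans hsub).
  exact: (sorted_filter ltn_trans _ (iota_ltn_sorted _ _)).
have hr' : row c < size (lrmin_pos s) by rewrite sn.
have [hp _] := minposP hr'.
apply/containsP; exists (nth 0 (lrmin_pos s) (row c) :: ks).
  split=> /=.
    rewrite path_min_sorted //; apply/allP => k /hks/and4P[hk mk _ /eqP ec].
    by rewrite /=  ltn_minpos_nonmin // ec.
  by rewrite hp; apply/allP => k /hks/and4P[].
apply: same_order_cons => //; apply/allP => _ /mapP[k /hks/and4P[hk mk /eqP er _] ->].
by rewrite ltn_minval_nonmin // er.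
Qed.

Hypothesis av2314 : ~ contains s [:: 2; 3; 1; 4].
Hypothesis av3124 : ~ contains s [:: 3; 1; 2; 4].

Lemma SE_independent : independent (@up_core n) (active (SE n s)).
Proof.
have h (c d : cell n) : active (SE n s) c -> active (SE n s) d ->
    ~~ ((row d < row c) && (col c < col d)).
  move=> /SE_active[k [hk mk <- <-]] /SE_active[l [hl ml <- <-]].
  apply/negP => /andP[hr hc].
  have hkl : k < l.
    by rewrite ltnNge; apply/negP => /(leq_col_of s); rewrite leqNgt hc.
  by have := leq_row_of_avoid3124 us av3124 hkl hl mk ml; rewrite leqNgt hr.
move=> c d hc hd; rewrite /up_core negb_or h //.
by rewrite h.
Qed.

Local Notation F := (fill_at (SE n s)).
Local Notation M := (fill_bound (SE n s)).
Let F_stair := @fill_at_stair n (SE n s).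
Let F_size := @fill_at_size n (SE n s).
Let F_perm := fill_at_perm SE_perm.

(** The third component is the rank that standardizing the cell gives to the entry, so that
    [tag_of k] is to be the tag at position [k] in the word of the encoding. *)
Definition tag_of (k : nat) : etag :=
  (row_of s k, col_of s k,
   if is_lrmin s k then 0
   else (count (fun y => y < nth 0 s k)
               (cellword (row_of s k) (col_of s k))).+1).

Lemma is_min_tag_of k : is_min (tag_of k) = is_lrmin s k.
Proof. by rewrite /is_min /tag_of /=; case: (is_lrmin s k). Qed.

Lemma fill_at_SE i j : i <= j < n -> F i j = standardize (cellword i j).
Proof.
move=> hij; have [c [<- <-]] := cell_exists hij.
by rewrite fill_at_cell ffunE.
Qed.

Lemma tag_of_col k : k < size s -> row_of s k <= col_of s k < n.
Proof. by move=> hk; rewrite leq_row_col // -sn ltn_col_of. Qed.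

Lemma mem_own_cellword k : k < size s -> ~~ is_lrmin s k ->
  nth 0 s k \in cellword (row_of s k) (col_of s k).
Proof.
move=> hk mk; have /andP[h1 h2] := tag_of_col hk.
by rewrite map_f // mem_cellpos ?(leq_ltn_trans h1) // hk mk !eqxx.
Qed.

Lemma valid_tag_of k : k < size s -> valid_tag n M (tag_of k).
Proof.
move=> hk; have hrc := tag_of_col hk; have /andP[h1 h2] := hrc.
rewrite /valid_tag /tag_row /tag_col is_min_tag_of /= h1 h2 /=.
have [mk|mk] := boolP (is_lrmin s k); first by rewrite row_of_lrmin // eqxx.
have := F_size (row_of s k) (col_of s k); apply: leq_ltn_trans.
have : (count (fun y => y < nth 0 s k)
   (cellword (row_of s k) (col_of s k))).+1 \in F (row_of s k) (col_of s k).
  by rewrite fill_at_SE //; apply: map_f; apply: mem_own_cellword.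
by rewrite (mem_is_perm _ (F_perm _ _)) => /andP[].
Qed.

Lemma tag_pos_cell i j k : i < n -> j < n -> k < size s ->
  (tag_pos n (tag_of k) == tag_pos n (i, j, 1)) = in_cell s i j k.
Proof.
move=> hi hj hk; have /andP[h1 h2] := tag_of_col hk.
have hr := leq_ltn_trans h1 h2.
rewrite in_cellE ?sn // /tag_pos eqn_lex //; last by case: is_min.
rewrite is_min_tag_of /tag_row /tag_col /=.
by case: (is_lrmin s k); rewrite /= ?andbF // eqSS andbC.
Qed.

(** Both lists are sorted by [tag_pos], the first by avoidance of [3124], and their blocks agree for
    each key: a single minimum, or one cell read from left to right. *)
Lemma tags_of : [seq tag_of k | k <- iota 0 (size s)] = tags n F.
Proof.
apply: (eq_from_key_filter (key := tag_pos n)).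
- rewrite (sorted_pairwise (@keyle_trans _ _)) pairwise_map.
  apply/(pairwiseP 0) => k l; rewrite !inE size_iota => hk hl hkl.
  rewrite !nth_iota // !add0n /=.
  rewrite (leq_tag_pos (valid_tag_of hk) (valid_tag_of hl)) !is_min_tag_of.
  rewrite /tag_row /tag_col /=.
  have := leq_col_of s (ltnW hkl); rewrite leq_eqVlt => /orP[/eqP e|->//].
  rewrite e eqxx /=; apply/orP; right.
  (* A minimum at [l] would open the common column, so the earlier [k] could not lie in it. *)
  have [//|mk] := boolP (is_lrmin s k); have [ml|ml] /= := boolP (is_lrmin s l).
    have := minpos_col_of hl ml; have := ltn_col_of hk; rewrite -e => hc hm.
    by have := col_ofP hk hc; rewrite hm leqnn leqNgt hkl.
  exact: leq_row_of_avoid3124.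
- exact: (sorted_tags F_stair F_perm F_size).
(* Valid tags have keys below [n * n.+1], so beyond this bound both blocks are empty. *)
move=> a; have [ha|ha] := ltnP a (n * n.+1); last first.
  have h0 (L : seq etag) : (forall t, t \in L -> valid_tag n M t) ->
      [seq t <- L | tag_pos n t == a] = [::].
    move=> hL; apply/eqP; rewrite -[_ == _]negbK -has_filter; apply/hasPn.
    move=> t /hL/and4P[h1 h2 _ _]; rewrite /tag_pos.
    case: (is_min t); nia.
  rewrite !h0 // => t; first by rewrite (mem_tags F_stair F_perm F_size) => /andP[].
  by case/mapP=> k; rewrite mem_iota => hk ->; apply: valid_tag_of.
rewrite (filter_tags F_stair F_perm F_size) // filter_map.
have hj : a %/ n.+1 < n by rewrite ltn_divLR.
have hr : a %% n.+1 < n.+1 by rewrite ltn_mod.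
rewrite /tags_at; move: (divn_eq a n.+1) hj.
case: (a %% n.+1) hr => [|i] hi; move: (a %/ n.+1) => j ea hj.
  have hj' : j < size (lrmin_pos s) by rewrite sn.
  have [hp mp] := minposP hj'.
  rewrite (@eq_in_filter _ _ (pred1 (nth 0 (lrmin_pos s) j))); last first.
    move=> k; rewrite mem_iota /= => hk; rewrite ea /tag_pos.
    have /andP[h1 h2] := tag_of_col hk; have h3 := leq_ltn_trans h1 h2.
    rewrite eqn_lex //; last by case: is_min.
    rewrite is_min_tag_of /tag_row /tag_col /=.
    apply/andP/eqP => [[/eqP ec]|->]; last by rewrite col_of_minpos // mp eqxx.
    have [mk _|//] := boolP (is_lrmin s k); by rewrite -ec minpos_col_of.
  rewrite filter_pred1_uniq ?iota_uniq ?mem_iota //= /tag_of mp.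
  by rewrite row_of_lrmin // col_of_minpos.
rewrite ltnS in hi.
rewrite (@eq_in_filter _ _ (in_cell s i j)); last first.
  by move=> k; rewrite mem_iota /= ea => hk; rewrite -tag_pos_cell.
(* The key may also decode to a pair below the diagonal, where both sides are empty. *)
have [hij|hji] := leqP i j; last first.
  have -> : F i j = [::].
    by apply: contrapT => /F_stair; rewrite leqNgt hji.
  rewrite /=; case e: (cellpos i j) => [//|k ks].
  have : k \in cellpos i j by rewrite e mem_head.
  rewrite mem_cellpos // => /and4P[hk _ /eqP er /eqP ec].
  by have := leq_row_col hk; rewrite er ec leqNgt hji.
rewrite fill_at_SE ?hij // /standardize -!map_comp; apply/eq_in_map => k.
rewrite mem_cellpos // => /and4P[hk mk /eqP er /eqP ec].
by rewrite /= /tag_of (negbTE mk) er ec.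
Qed.

(** A larger value means a row that is no lower. Within a row the minimum is least, and by avoidance
    of [2314] the smaller of two other entries has a column at least that of the larger; in a common
    cell the ranks decide. *)
Lemma ltn_tag_of k l : k < size s -> l < size s -> nth 0 s k < nth 0 s l ->
  tag_val n M (tag_of k) < tag_val n M (tag_of l).
Proof.
move=> hk hl hv; have vk := valid_tag_of hk; have vl := valid_tag_of hl.
rewrite (ltn_tag_val vk vl) (ltn_tag_block vk vl) (eq_tag_block vk vl).
rewrite !is_min_tag_of /tag_row /tag_col /=.
have := leq_row_of (ltnW hv); rewrite leq_eqVlt => /orP[/eqP e|->//].
rewrite xpair_eqE e eqxx ltnn /=.
have ml : ~~ is_lrmin s l.
  apply/negP => ml; have hcl := ltn_col_of hl.
  have := row_ofP k hcl; rewrite minpos_col_of // -e row_of_lrmin // leqnn.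
  by rewrite leqNgt hv.
rewrite ml; have [//|mk] /= := boolP (is_lrmin s k).
have [//|hle] := ltnP (col_of s l) (col_of s k).
have ec : col_of s k = col_of s l.
  have [hkl|hlk] := ltnP k l; first exact: col_of_avoid2314.
  by apply/eqP; rewrite eqn_leq hle leq_col_of.
have hk' := mem_own_cellword hk mk; have hl' := mem_own_cellword hl ml.
rewrite ec eqxx (negbTE ml) /= -e; rewrite ec -e in hk'.
by rewrite (count_ltn_mono hk' hl').
Qed.

(** The word on the right depends only on [SE n s], so the encoding determines [s] up to order
    isomorphism. *)
Lemma same_order_SE_word : same_order s (fill_word (SE n s)).
Proof.
rewrite /fill_word -tags_of; split; first by rewrite !size_map size_iota.
move=> k l hk hl; rewrite -map_comp !(nth_map 0) ?size_iota //.
rewrite !nth_iota // !add0n /=.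
have [hkl|hlk] := ltnP (nth 0 s k) (nth 0 s l); first by rewrite ltn_tag_of.
move: hlk; rewrite leq_eqVlt => /orP[|hlk]; last first.
  by have := ltn_tag_of hl hk hlk; lia.
by rewrite nth_uniq // => /eqP->; rewrite ltnn.
Qed.

End Encode.

Theorem theorem4p2 (P : set (seq nat)) (n : nat)
    (hP : forall p, P p -> [/\ is_perm p, p <> [::] & skew_indecomposable p]) :
  set_bij
    (Av_n n ([set [:: 2; 3; 1; 4]; [:: 3; 1; 2; 4]] `|` one_plus P))
    (WI (@up_core n) (Av_plus ([set [:: 2; 3; 1; 4]; [:: 3; 1; 2; 4]] `|` P)))
    (@SE n).
Proof.
split.
- move=> s [[ps av] sn]; have us := is_perm_uniq ps.
  have av1 : ~ contains s [:: 2; 3; 1; 4] by apply: av; left; left.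
  have av2 : ~ contains s [:: 3; 1; 2; 4] by apply: av; left; right.
  split; first exact: SE_independent.
  move=> c hc; split=> //; split; first exact: SE_perm.
  move=> p [[->|->]|hp] hcon.
  + exact/av1/(SE_contains hcon).
  + exact/av2/(SE_contains hcon).
  have [pp _ _] := hP _ hp.
  apply: (av (direct_sum [:: 1] p)); first by right; exists p.
  exact: (SE_contains_one_plus us sn pp hcon).
(* Injectivity: both permutations are order isomorphic to the word of their common encoding. *)
- move=> s t; rewrite !inE => -[[ps avs] sn] [[pt avt] tn] e.
  apply: is_perm_same_order_inj => //.
  apply: (@same_order_trans _ (fill_word (SE n s))).
    apply: same_order_SE_word => //; first exact: is_perm_uniq.
      by apply: avs; left; left.
    by apply: avs; left; right.
  rewrite e; apply/same_order_sym/same_order_SE_word => //.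
  + exact: is_perm_uniq.
  + by apply: avt; left; left.
  by apply: avt; left; right.
(* Surjectivity: the preimage of [f] is its standardized word. *)
move=> f [ind hf].
(* [hf] speaks of active cells only; the empty word is a permutation as well. *)
have fp c : is_perm (f c).
  have [->//|/eqP h] := eqVneq (f c) [::].
  by have [[]] := hf c h.
have F_stair := @fill_at_stair n f; have F_size := @fill_at_size n f.
have F_perm := fill_at_perm fp.
have uw : uniq (fill_word f) by exact: (uniq_word F_stair F_perm F_size).
have so := standardize_same_order (fill_word f).
have hn : size (lrmin_pos (standardize (fill_word f))) = n.
  rewrite (lrmin_pos_same_order so).
  exact: (size_lrmin_word F_stair F_perm F_size).
have pw := is_perm_standardize uw.
exists (standardize (fill_word f)); last first.
  rewrite (SE_same_order so (is_perm_uniq pw) uw hn).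
  exact: SE_fill_word.
have F_chain i j k l : fill_at f i j <> [::] -> fill_at f k l <> [::] ->
    ~~ ((k < i) && (j < l)).
  case/fill_at_neq0=> c [<- <- hc] /fill_at_neq0[d [<- <- hd]].
  by have := ind _ _ hc hd; rewrite /up_core negb_or => /andP[].
(* An empty cell contains no non-empty pattern, so only active cells, governed by [hf], are left. *)
have avF p i j : ([set [:: 2; 3; 1; 4]; [:: 3; 1; 2; 4]] `|` P) p -> p <> [::] ->
    ~ contains (fill_at f i j) p.
  move=> hp p0 hcon.
  have h0 : fill_at f i j <> [::].
    move=> e; move: hcon; rewrite e => -[t]; rewrite subseq0 => /eqP-> [+ _].
    by move/esym/size0nil.
  have [c [er ec hc]] := fill_at_neq0 h0.
  have [[_ av] _] := hf c hc; apply: (av p hp).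
  by rewrite -fill_at_cell er ec.
split=> //; split=> // q hq hcon.
have {}hcon : contains (fill_word f) q by exact: contains_same_order hcon.
case: hq hcon => [[->|->]|[p hp <-]] hcon.
- have [i [j]] := word_avoid2314 F_stair F_perm F_size F_chain hcon.
  by apply: avF => //; left; left.
- have [i [j]] := word_avoid3124 F_stair F_perm F_size F_chain hcon.
  by apply: avF => //; left; right.
have [pp p0 ip] := hP _ hp.
have [i [j]] := word_avoid_one_plus F_stair F_perm F_size F_chain pp p0 ip hcon.
by apply: avF => //; right.
Qed.
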